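(* Let $\mathbf R=(R(n,k))_{n,k\ge0}$ be the infinite lower triangular matrix with entries $R(n,k)=2^{(n-k)/2}\frac{n!}{k!}\langle t^n\rangle U^k(t)$, where $U(t)$ is the power series defined in the context. The inverse $\mathbf R^{-1}$ of $\mathbf R$ is given by $(R^{-1}(n,k))_{n,k\ge0}$ with $$R^{-1}(n,k)=2^{(n-k)/2}\frac{(n-1)!}{(k-1)!}\langle t^{-k}\rangle U^{-n}(t),$$ where the case $k=0$ has to be interpreted as $R^{-1}(0,0)=1$ and $R^{-1}(n,0)=0$ for $n\ge1$. Moreover, $\mathbf R^{-1}$ has integer entries, and $R^{-1}(n,k)\ne0$ only if $n$ and $k$ have the same parity.
   Context: The integers $u(n)$, $n\ge0$, are defined by $u(0)=1$ and $$u(n)=\prod_{j=1}^n(4j-1)^2-\sum_{m=0}^{n-1}\binom{2n+1}{2m+1}\Bigl(\prod_{j=1}^{n-m}(4j-3)^2\Bigr)u(m)\quad(n\ge1),$$ and $U(t)=\sum_{n\ge0}\frac{u(n)}{(2n+1)!}t^{2n+1}$; equivalently $$U(t)=t\,\frac{{}_2F_1\left[\frac34,\frac34;\frac32;4t^2\right]}{{}_2F_1\left[\frac14,\frac14;\frac12;4t^2\right]}.$$ For a formal Laurent series $F(t)$, $\langle t^N\rangle F(t)$ denotes the coefficient of $t^N$ in $F(t)$. It is known that all entries $R(n,k)$ are integers. *)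

(* Defs.v *)
From mathcomp Require Import all_boot all_order all_algebra.

Set Implicit Arguments.
Unset Strict Implicit.
Unset Printing Implicit Defensive.

Import Order.TTheory GRing.Theory Num.Theory.
Local Open Scope ring_scope.

Section CourseOfValues.
Variables (T : Type) (x0 : T) (step : nat -> (nat -> T) -> T).

(* [cov] is the sequence f with f n = step n f, for a [step n] that reads only
   the values of its argument below n; see [covE]. *)
Fixpoint cov_seq (n : nat) : seq T :=
  if n is n'.+1 then rcons (cov_seq n') (step n' (nth x0 (cov_seq n')))
  else [::].

Definition cov (n : nat) : T := nth x0 (cov_seq n.+1) n.

Lemma size_cov_seq n : size (cov_seq n) = n.
Proof. by elim: n => //= n IHn; rewrite size_rcons IHn. Qed.

Lemma nth_cov_seq n i : (i < n)%N -> nth x0 (cov_seq n) i = cov i.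
Proof.
elim: n => // n IHn; rewrite ltnS leq_eqVlt => /predU1P[-> // | lt_in].
by rewrite [cov_seq _]/= nth_rcons size_cov_seq lt_in IHn.
Qed.

Lemma covE :
  (forall n f g, (forall i, (i < n)%N -> f i = g i) -> step n f = step n g) ->
  forall n, cov n = step n cov.
Proof.
move=> step_ext n; rewrite /cov [cov_seq _]/= nth_rcons size_cov_seq ltnn eqxx.
by apply: step_ext => i; apply: nth_cov_seq.
Qed.

End CourseOfValues.

Definition u_step (n : nat) (v : nat -> int) : int :=
  if n is 0 then 1 else
  \prod_(1 <= j < n.+1) (4 * j%:Z - 1) ^+ 2
  - \sum_(0 <= m < n) 'C(2 * n + 1, 2 * m + 1)%:Z
      * (\prod_(1 <= j < (n - m).+1) (4 * j%:Z - 3) ^+ 2) * v m.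

Definition u : nat -> int := cov 0 u_step.

Lemma uE n : u n = u_step n u.
Proof.
apply: covE => -[|m] f g eq_fg //=; congr (_ - _).
by apply: eq_big_nat => i /andP[_ lt_im]; rewrite eq_fg.
Qed.

Lemma u0 : u 0 = 1.
Proof. exact: uE. Qed.

Lemma uS n : (1 <= n)%N ->
  u n = \prod_(1 <= j < n.+1) (4 * j%:Z - 1) ^+ 2
        - \sum_(0 <= m < n) 'C(2 * n + 1, 2 * m + 1)%:Z
            * (\prod_(1 <= j < (n - m).+1) (4 * j%:Z - 3) ^+ 2) * u m.
Proof. by case: n => // n _; rewrite uE. Qed.

Section Laurent.
Variable F : fieldType.

(* Power series are their coefficient sequences. *)
Definition ps_mul (a b : nat -> F) (n : nat) : F :=
  \sum_(i < n.+1) a i * b (n - i)%N.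

Definition ps_inv (a : nat -> F) : nat -> F :=
  cov 0 (fun n b => (a 0)^-1 * ((n == 0)%:R - \sum_(i < n) a (n - i)%N * b i)).

(* [Laurent v a] stands for t^v * (a 0 + a 1 * t + a 2 * t^2 + ...).  As [a 0]
   may vanish, several terms represent the same Laurent series: equality of
   Laurent series is equality of all the coefficients [lcoef]. *)
Record laurent := Laurent { lshift : int; lseries : nat -> F }.

(* The coefficient of t^N. *)
Definition lcoef (N : int) (f : laurent) : F :=
  if N - lshift f is Posz i then lseries f i else 0.

Definition lone : laurent := Laurent 0 (fun n => (n == 0)%:R).

Definition lmul (f g : laurent) : laurent :=
  Laurent (lshift f + lshift g) (ps_mul (lseries f) (lseries g)).

(* Meaningful when [lseries f 0 != 0]; see [lmulV]. *)
Definition linv (f : laurent) : laurent :=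
  Laurent (- lshift f) (ps_inv (lseries f)).

Definition lexp (f : laurent) (z : int) : laurent :=
  match z with
  | Posz n => iter n (lmul f) lone
  | Negz n => iter n.+1 (lmul (linv f)) lone
  end.

Lemma ps_invE (a : nat -> F) n :
  ps_inv a n =
    (a 0)^-1 * ((n == 0)%:R - \sum_(i < n) a (n - i)%N * ps_inv a i).
Proof.
rewrite {1}/ps_inv covE // => m f g eq_fg; congr (_ * (_ - _)).
by apply: eq_bigr => i _; rewrite eq_fg.
Qed.

Lemma lmulV (f : laurent) : lseries f 0 != 0 ->
  forall N, lcoef N (lmul (linv f) f) = lcoef N lone.
Proof.
move=> f0 N; rewrite /lcoef /= addNr subr0; case: N => // n.
rewrite /ps_mul big_ord_recr /= subnn ps_invE [_ * lseries f 0]mulrC mulVKf //.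
by rewrite addrC -(eq_bigr _ (fun i _ => mulrC _ _)) subrK.
Qed.

(* U(t) = t * (u(0)/1! + u(1)/3! * t^2 + u(2)/5! * t^4 + ...) *)
Definition U : laurent :=
  Laurent 1 (fun i => if odd i then 0 else (u i./2)%:~R / (i.+1)`!%:R).

Lemma lcoef_U (N : nat) :
  lcoef N%:Z U = if odd N then (u N./2)%:~R / N`!%:R else 0.
Proof.
case: N => [|N] //; rewrite /lcoef [lshift _]/= -addn1 PoszD addrK addn1 /=.
by rewrite uphalf_half; case: (odd N).
Qed.

Lemma lcoef_U_neg (N : nat) : lcoef (Negz N) U = 0.
Proof. by []. Qed.

End Laurent.

Section Triangular.
Variable F : pzRingType.

Definition lower_triangular (A : nat -> nat -> F) : Prop :=
  forall n k, (n < k)%N -> A n k = 0.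

(* The product of infinite matrices, for a lower triangular left factor. *)
Definition imx_mul (A B : nat -> nat -> F) (n k : nat) : F :=
  \sum_(m < n.+1) A n m * B m k.

Definition imx_one (n k : nat) : F := (n == k)%:R.

Definition is_inverse (A B : nat -> nat -> F) : Prop :=
  [/\ lower_triangular A, lower_triangular B,
      forall n k, imx_mul A B n k = imx_one n k
    & forall n k, imx_mul B A n k = imx_one n k].

End Triangular.

Section Matrices.
Variable F : rcfType.

(* 2^((n - k)/2), where n - k may be odd or negative. *)
Definition two_half (n k : nat) : F := Num.sqrt 2 ^ (n%:Z - k%:Z).

Definition Rmx (n k : nat) : F :=
  two_half n k * (n`!%:R / k`!%:R) * lcoef n%:Z (lexp (U F) k%:Z).

(* For n = 0 < k the undefined (n-1)! is read as 1; as U^0 = 1 has no t^-k term,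
   the entry is 0. *)
Definition Rmx_inv (n k : nat) : F :=
  if k == 0 then (n == 0)%:R else
  two_half n k * ((n.-1)`!%:R / (k.-1)`!%:R)
    * lcoef (- k%:Z) (lexp (U F) (- n%:Z)).

End Matrices.

(* Main.v *)
Require Import Defs.
From mathcomp Require Import all_boot all_order all_algebra.
From mathcomp Require Import ring zify.

(** Write [U = t A], where [A] is an even power series with constant term 1,
    and write [D] for the derivation [t d/dt].

    The product of the two matrices in the order [R^-1 R] is computed entry by
    entry.  For [n > 0] and up to powers of 2 and factorials, its entry (n, k)
    is the sum over m of [m <t^-m> U^-n <t^m> U^k].  This is the constant term
    of [U^-n D(U^k)], that is, [k] times the residue of [U^(k-1-n) U'].  A
    derivative has no residue, so this vanishes unless [n = k], and then [U'/U]
    has residue 1.  The lemma [residue_exp] is this computation.  It is carried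
    out on the polynomials that truncate [A] and its inverse: a coefficient of a
    product depends only on the coefficients of the factors up to the same
    index, and [D] multiplies each coefficient by its index.

    For lower triangular matrices a left inverse is a right inverse, because the
    leading square blocks are multiplied independently of the rest.  As the
    diagonal of [R] is 1, the identity [R R^-1 = 1] now determines the entries
    of [R^-1] in a row from those in earlier rows: integrality and the parity
    condition pass from [R] to [R^-1] along this recurrence.

    The entries of [R] are integers because [U] is an exponential generating
    function of integers without constant term, and so is then [U^k / k!]
    ([egf_exp_int]); and since [U] is odd, the exponent of [Num.sqrt 2] is even
    wherever the entry does not vanish. *)

Set Implicit Arguments.
Unset Strict Implicit.
Unset Printing Implicit Defensive.

Import Order.TTheory GRing.Theory Num.Theory.
Local Open Scope ring_scope.

(** * Polynomials up to a degree *)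

Section Truncation.
Variable F : fieldType.
Implicit Types (p q r s : {poly F}) (a : nat -> F).

Definition eq_upto N p q := forall i, (i <= N)%N -> p`_i = q`_i.

Lemma eq_upto_refl N p : eq_upto N p p.
Proof. by []. Qed.

Lemma eq_uptoM N p q r s :
  eq_upto N p q -> eq_upto N r s -> eq_upto N (p * r) (q * s).
Proof.
move=> pq rs i le_iN; rewrite !coefM; apply: eq_bigr => j _.
by rewrite pq ?rs //; have := ltn_ord j; lia.
Qed.

Lemma eq_uptoX N p q k : eq_upto N p q -> eq_upto N (p ^+ k) (q ^+ k).
Proof. by move=> pq; elim: k => // k IHk; rewrite !exprS; apply: eq_uptoM. Qed.

Definition euler p := 'X * p^`().

Lemma coef_euler p i : (euler p)`_i = i%:R * p`_i.
Proof. by rewrite coefXM coef_deriv mulr_natl; case: i. Qed.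

Lemma eulerM p q : euler (p * q) = euler p * q + p * euler q.
Proof. by rewrite /euler derivM; ring. Qed.

Lemma eulerXn p n : euler (p ^+ n) = n%:R * (p ^+ n.-1 * euler p).
Proof. by rewrite /euler deriv_exp -mulr_natl; ring. Qed.

Lemma eq_upto_euler N p q : eq_upto N p q -> eq_upto N (euler p) (euler q).
Proof. by move=> pq i le_iN; rewrite !coef_euler pq. Qed.

(** The coefficient of [t^n] on the left is the residue of
    [(t p)^-n t^-1 euler ((t p)^k)], with [q] standing for the inverse of [p].
    With [d = n - k > 0], it reduces to the coefficient of [t^d] in
    [k (q^d - q^(d-1) euler q) = k (q^d - euler (q^d) / d)], which vanishes. *)
Lemma residue_exp p q n k : [pchar F] =i pred0 -> (k <= n)%N ->
  eq_upto n (p * q) 1 ->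
  (euler (('X * p) ^+ k) * q ^+ n)`_n = if n == k then k%:R else 0.
Proof.
move=> char0 le_kn pq1; rewrite eulerXn.
case: k le_kn => [|k] lt_kn; first by rewrite !mul0r coef0 if_same.
have [d def_n] : exists d, n = (k.+1 + d)%N by exists (n - k.+1)%N; lia.
have Dpq0 : eq_upto n (euler (p * q)) 0.
  move=> i le_in; rewrite (eq_upto_euler pq1 le_in).
  rewrite coef_euler coef1 coef0.
  by case: i {le_in} => [|i]; rewrite ?mul0r ?mulr0.
(* Here [k] factors [p * q] become 1, and [euler p * q] becomes
   [- p * euler q]. *)
have -> : k.+1%:R * (('X * p) ^+ k.+1.-1 * euler ('X * p)) * q ^+ n
        = 'X^(k.+1) * ((p * q) ^+ k * (p * q - p * euler q + euler (p * q))
          * q ^+ d * (k.+1%:R)%:P).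
  rewrite def_n !eulerM /euler derivX polyC_natr [k.+1.-1]/=.
  by rewrite exprD !exprMn !exprS; ring.
rewrite coefXnM ltnNge lt_kn coefMC.
have pqk := eq_uptoX k pq1; rewrite expr1n in pqk.
have -> : ((p * q) ^+ k * (p * q - p * euler q + euler (p * q)) * q ^+ d)
            `_(n - k.+1) = ((1 - p * euler q) * q ^+ d)`_(n - k.+1).
  rewrite -[1 - _]mul1r.
  apply: (eq_uptoM (eq_uptoM pqk _) (@eq_upto_refl n _)) => //; last by lia.
  by move=> i le_in; rewrite coefD Dpq0 // coef0 addr0 !coefB pq1.
have -> : (n - k.+1 = d)%N by lia.
rewrite {1}def_n -[X in _ == X]addn0 eqn_add2l.
case: d def_n => [|d] def_n.
  by rewrite expr0 mulr1 coefB coef1 mulrCA coefXM subr0 mul1r.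
have le_dn : (d.+1 <= n)%N by lia.
have d_neq0 : d.+1%:R != 0 :> F by rewrite ((pcharf0P F).1 char0).
have -> : (1 - p * euler q) * q ^+ d.+1
        = q ^+ d.+1 - (p * q) * (q ^+ d * euler q) by rewrite exprS; ring.
have eq_d : (q ^+ d * euler q)`_d.+1 = (q ^+ d.+1)`_d.+1.
  apply: (mulfI d_neq0).
  by rewrite -(coef_euler (q ^+ d.+1)) eulerXn -polyC_natr coefCM.
by rewrite coefB (eq_uptoM pq1 (@eq_upto_refl n _)) // mul1r eq_d subrr mul0r.
Qed.

(** * Laurent series and their truncations *)

Definition trunc N a : {poly F} := \poly_(i < N.+1) a i.

Lemma coef_trunc N a i : (i <= N)%N -> (trunc N a)`_i = a i.
Proof. by move=> le_iN; rewrite coef_poly ltnS le_iN. Qed.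

Lemma lshift_iter (f : laurent F) k :
  Defs.lshift (iter k (lmul f) (lone F)) = Defs.lshift f *+ k.
Proof. by elim: k => //= k ->; rewrite mulrS. Qed.

Lemma lseries_iter N (f : laurent F) k i : (i <= N)%N ->
  lseries (iter k (lmul f) (lone F)) i = (trunc N (lseries f) ^+ k)`_i.
Proof.
elim: k i => [|k IHk] i le_iN; first by rewrite expr0 coef1.
rewrite exprS coefM; apply: eq_bigr => j _; have := ltn_ord j => lt_ji.
by rewrite coef_trunc ?IHk //; lia.
Qed.

Lemma lexpN (f : laurent F) n :
  lexp f (- n%:Z) = iter n (lmul (linv f)) (lone F).
Proof. by case: n. Qed.

Lemma trunc_inv N a : a 0 != 0 ->
  eq_upto N (trunc N a * trunc N (ps_inv a)) 1.
Proof.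
move=> a0 i le_iN; rewrite mulrC coef1 coefM.
have := @lmulV F (Laurent 0 a) a0 i%:Z; rewrite /lcoef /= addn0 => <-.
apply: eq_bigr => j _; have := ltn_ord j => lt_ji.
by rewrite !coef_trunc //; lia.
Qed.

Lemma coef_exp_odd p k i : (forall j, odd j -> p`_j = 0) -> odd i ->
  (p ^+ k)`_i = 0.
Proof.
move=> even_p; elim: k i => [|k IHk] i odd_i.
  by rewrite coef1; case: i odd_i.
rewrite exprS coefM big1 // => j _; have [odd_j|even_j] := boolP (odd j).
  by rewrite even_p ?mul0r.
by rewrite IHk ?mulr0 // oddB ?odd_i // -ltnS.
Qed.

End Truncation.

(** * Exponential generating functions of integers *)

Lemma fact_neq0 (F : numDomainType) n : n`!%:R != 0 :> F.
Proof. by rewrite pnatr_eq0 -lt0n fact_gt0. Qed.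

(** Division by [k!] is harmless because [p^k / k!] is an antiderivative of
    [p' p^(k-1) / (k-1)!], and products of exponential generating functions have
    binomial coefficients in them. *)
Lemma egf_exp_int (F : archiRealFieldType) (p : {poly F}) : p`_0 = 0 ->
  (forall i, i`!%:R * p`_i \is a Num.int) ->
  forall k n, n`!%:R / k`!%:R * (p ^+ k)`_n \is a Num.int.
Proof.
move=> p0 int_p; elim=> [|k IHk] [|n].
- by rewrite expr0 coef1 divr1 mulr1.
- by rewrite expr0 coef1 mulr0.
- by rewrite exprS coefM big_ord1 p0 mul0r mulr0.
have k_neq0 : k.+1%:R != 0 :> F by rewrite pnatr_eq0.
have Dp : n.+1%:R * (p ^+ k.+1)`_n.+1 =
    k.+1%:R * \sum_(j < n.+1) j.+1%:R * p`_j.+1 * (p ^+ k)`_(n - j).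
  rewrite mulr_natl -coef_deriv deriv_exp coefMn coefM -[LHS]mulr_natl.
  by congr (_ * _); apply: eq_bigr => j _; rewrite coef_deriv mulr_natl.
have -> : n.+1`!%:R / k.+1`!%:R * (p ^+ k.+1)`_n.+1 =
    \sum_(j < n.+1) 'C(n, j)%:R * (j.+1`!%:R * p`_j.+1)
      * ((n - j)`!%:R / k`!%:R * (p ^+ k)`_(n - j)).
  rewrite [n.+1`!]factS natrM.
  transitivity (n`!%:R / k.+1`!%:R * (n.+1%:R * (p ^+ k.+1)`_n.+1)).
    by ring.
  rewrite Dp factS natrM.
  transitivity (n`!%:R / k`!%:R
      * \sum_(j < n.+1) j.+1%:R * p`_j.+1 * (p ^+ k)`_(n - j)).
    move: (k.+1%:R : F) k_neq0 => c c_neq0; field.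
    by rewrite c_neq0 fact_neq0.
  rewrite mulr_sumr; apply: eq_bigr => j _.
  have := ltn_ord j; rewrite ltnS => le_jn.
  by rewrite -(bin_fact le_jn) [j.+1`!]factS !natrM; ring.
by apply: rpred_sum => j _; rewrite rpredM // rpredM // natr_int.
Qed.

(** * Triangular matrices *)

(** The product of the leading blocks of size [N] is the leading block of the
    product, so this is the corresponding fact about square matrices. *)
Lemma lower_triangular_inverseC (F : comNzRingType) (A B : nat -> nat -> F) :
  lower_triangular A -> lower_triangular B ->
  (forall n k, imx_mul B A n k = imx_one F n k) ->
  forall n k, imx_mul A B n k = imx_one F n k.
Proof.
move=> triA triB BA n k; pose N := (n + k).+1.
pose block (C : nat -> nat -> F) : 'M[F]_N := \matrix_(i, j) C i j.
have blockM C D (i j : 'I_N) : lower_triangular C ->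
    (block C *m block D) i j = imx_mul C D i j.
  move=> triC; rewrite mxE /imx_mul.
  rewrite (big_ord_widen N (fun m => C i m * D m j)) //.
  rewrite [RHS]big_mkcond /=; apply: eq_bigr => m _; rewrite !mxE ltnS.
  by case: leqP => // /triC ->; rewrite mul0r.
have /mulmx1C AB1 : block B *m block A = 1%:M.
  by apply/matrixP => i j; rewrite blockM // BA mxE.
have lt_nN : (n < N)%N by rewrite /N; lia.
have lt_kN : (k < N)%N by rewrite /N; lia.
by have := blockM A B (Ordinal lt_nN) (Ordinal lt_kN) triA; rewrite AB1 mxE.
Qed.

(** The last term of row [n] of [A B = 1] is [B n k] itself, because [A n n] is
    1; the others involve only earlier rows of [B]. *)
Lemma unitriangular_inverseE (F : comNzRingType) (A B : nat -> nat -> F) :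
  is_inverse A B -> (forall n, A n n = 1) ->
  forall n k, B n k = (n == k)%:R - \sum_(m < n) A n m * B m k.
Proof.
case=> _ _ AB _ diagA n k; have := AB n k; rewrite /imx_mul big_ord_recr /=.
by rewrite diagA mul1r /imx_one => <-; rewrite addrAC subrr add0r.
Qed.

(** * The matrices of the series U *)

Section Matrices.
Variable F : archiRcfType.

Let A : nat -> F := lseries (U F).

Lemma U_series0 : A 0 = 1.
Proof. by rewrite /A /= u0 divr1. Qed.

Lemma sqrt2_neq0 : Num.sqrt 2 != 0 :> F.
Proof. by rewrite sqrtr_eq0 -ltNge ltr0n. Qed.

Lemma two_half_trans n m k : two_half F n m * two_half F m k = two_half F n k.
Proof.
by rewrite /two_half -expfzDr ?sqrt2_neq0 // addrA subrK.
Qed.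

Lemma two_half_nn n : two_half F n n = 1.
Proof. by rewrite /two_half subrr. Qed.

(** With the factor ['X] kept, the formula covers [n < k] as well, where both
    sides vanish. *)
Lemma lcoef_exp_U N n k : (n <= N)%N ->
  lcoef n%:Z (lexp (U F) k%:Z) = (('X * trunc N A) ^+ k)`_n.
Proof.
move=> le_nN; rewrite /lcoef /= lshift_iter /= pmulrn intz exprMn coefXnM.
have [lt_nk|le_kn] := ltnP n k.
  by case def_i: (n%:Z - k%:Z) => [i|i] //; lia.
by rewrite subzn // (lseries_iter (N := N)) //; lia.
Qed.

Lemma lcoef_expV_U N n k : (k <= n)%N -> (n <= N)%N ->
  lcoef (- k%:Z) (lexp (U F) (- n%:Z)) = (trunc N (ps_inv A) ^+ n)`_(n - k).
Proof.
move=> le_kn le_nN; rewrite lexpN /lcoef lshift_iter /=.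
rewrite mulNrn pmulrn intz opprK.
by rewrite addrC subzn // (lseries_iter (N := N)) //; lia.
Qed.

Lemma Rmx_triangular : lower_triangular (@Rmx F).
Proof.
move=> n k lt_nk; rewrite /Rmx (lcoef_exp_U _ (leqnn n)) exprMn coefXnM lt_nk.
by rewrite mulr0.
Qed.

Lemma Rmx_inv_triangular : lower_triangular (@Rmx_inv F).
Proof.
move=> n k lt_nk; rewrite /Rmx_inv gtn_eqF; last by lia.
rewrite lexpN /lcoef lshift_iter /= mulNrn pmulrn intz opprK.
by case def_i: (- k%:Z + n%:Z) => [i|i]; rewrite ?mulr0 //; lia.
Qed.

Lemma Rmx_diag n : Rmx F n n = 1.
Proof.
rewrite /Rmx two_half_nn mul1r divff ?fact_neq0 // mul1r.
rewrite (lcoef_exp_U _ (leqnn n)) exprMn coefXnM ltnn subnn.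
by rewrite -horner_coef0 horner_exp horner_coef0 coef_trunc ?U_series0 ?expr1n.
Qed.

Lemma Rmx_parity n k : Rmx F n k != 0 -> odd n = odd k.
Proof.
apply: contra_neq_eq => neq_nk.
rewrite /Rmx (lcoef_exp_U _ (leqnn n)) exprMn coefXnM.
have [|le_kn] := ltnP n k; first by rewrite mulr0.
rewrite coef_exp_odd ?mulr0 //; last by rewrite oddB // -negb_eqb.
by move=> j odd_j; rewrite coef_poly /A /= odd_j if_same.
Qed.

Lemma two_half_int n k : (k <= n)%N -> odd n = odd k ->
  two_half F n k \is a Num.int.
Proof.
move=> le_kn eq_odd; rewrite /two_half subzn //.
have -> : (n - k = 2 * (n - k)./2)%N by lia.
by rewrite -exprnP exprM sqr_sqrtr ?ler0n // rpredX ?natr_int.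
Qed.

(** A nonvanishing entry has [n] and [k] of the same parity, so its power of 2
    and its coefficient are separately integral. *)
Lemma Rmx_int n k : Rmx F n k \is a Num.int.
Proof.
have [->|nz_nk] := eqVneq (Rmx F n k) 0; first exact: rpred0.
have [/Rmx_triangular R0|le_kn] := ltnP n k; first by rewrite R0 eqxx in nz_nk.
rewrite /Rmx -mulrA rpredM ?(two_half_int le_kn (Rmx_parity nz_nk)) //.
rewrite (lcoef_exp_U _ (leqnn n)) egf_exp_int ?coefXM // => i.
rewrite coefXM; case: i => [|i]; rewrite ?mulr0 ?rpred0 //= coef_poly /A /=.
case: ifP => _; last by rewrite mulr0 rpred0.
by case: ifP => _; rewrite ?mulr0 ?rpred0 // mulrC divfK ?fact_neq0 // intr_int.
Qed.

Lemma Rmx_inv_mul n k : imx_mul (@Rmx_inv F) (@Rmx F) n k = imx_one F n k.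
Proof.
have [lt_nk|le_kn] := ltnP n k.
  rewrite /imx_one ltn_eqF // /imx_mul big1 // => m _.
  by rewrite [Rmx _ _ _]Rmx_triangular ?mulr0 //; have := ltn_ord m; lia.
case: n le_kn => [|n] le_kn.
  by case: k le_kn => // _; rewrite /imx_mul big_ord1 Rmx_diag mulr1.
(* The quotient of [m!] and [(m-1)!] turns the coefficient of [U^k] into one of
   [euler (U^k)], so that the sum over [m] is a coefficient of a product. *)
have term (m : 'I_n.+2) : Rmx_inv F n.+1 m * Rmx F m k
    = two_half F n.+1 k * (n`!%:R / k`!%:R)
      * ((euler (('X * trunc n.+1 A) ^+ k))`_m
         * (trunc n.+1 (ps_inv A) ^+ n.+1)`_(n.+1 - m)).
  have := ltn_ord m; rewrite ltnS => le_mn; rewrite coef_euler /Rmx_inv.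
  case: eqVneq => [->|m_neq0]; first by rewrite !mul0r mulr0.
  rewrite /Rmx (lcoef_exp_U k le_mn) (lcoef_expV_U le_mn (leqnn _)).
  rewrite -(two_half_trans n.+1 m k) -[in m`!](prednK (n := m)) ?lt0n //.
  rewrite factS natrM prednK ?lt0n //=; field.
  by rewrite !fact_neq0.
rewrite /imx_mul (eq_bigr _ (fun m _ => term m)) -mulr_sumr -coefM.
rewrite residue_exp //; first last.
- by apply: trunc_inv; rewrite U_series0 oner_neq0.
- exact: pchar_num.
rewrite /imx_one; case: eqVneq => [<-|_]; last by rewrite mulr0.
rewrite two_half_nn mul1r factS natrM mulr1n; field.
by rewrite fact_neq0 nat1r pnatr_eq0.
Qed.

Lemma Rmx_is_inverse : is_inverse (@Rmx F) (@Rmx_inv F).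
Proof.
split; [exact: Rmx_triangular | exact: Rmx_inv_triangular | |].
  apply: lower_triangular_inverseC Rmx_inv_mul.
    exact: Rmx_triangular.
  exact: Rmx_inv_triangular.
exact: Rmx_inv_mul.
Qed.

End Matrices.

Theorem proposition2 (F : archiRcfType) :
  [/\ is_inverse (@Rmx F) (@Rmx_inv F),
      forall n k : nat, Rmx_inv F n k \is a Num.int
    & forall n k : nat, Rmx_inv F n k != 0 -> odd n = odd k].
Proof.
have invR := Rmx_is_inverse F.
have invE := unitriangular_inverseE invR (@Rmx_diag F).
split=> // n k.
  elim/ltn_ind: n => n IHn.
  rewrite invE rpredB ?natr_int // rpred_sum // => m _.
  by rewrite rpredM ?Rmx_int ?IHn.
elim/ltn_ind: n => n IHn; apply: contra_neq_eq => neq_nk; rewrite invE.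
have [eq_nk|_] := eqVneq n k; first by rewrite eq_nk eqxx in neq_nk.
rewrite big1 ?subr0 // => m _; apply/eqP; rewrite mulf_eq0.
apply: contraNT neq_nk; rewrite negb_or => /andP[/Rmx_parity -> /IHn -> //].
Qed.
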